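(* Let $\Lambda$ be a finite, strongly connected $k$-graph, let $\delta\in(0,1)$, and suppose that $w_\delta$ is a weight satisfying $w_\delta(\lambda)=\operatorname{diam}[\lambda]$ for all $\lambda\in F\mathcal B_\Lambda$. Then the spectral triple $(C_{\rm Lip}(X_{\mathcal B_\Lambda}),\ell^2(F\mathcal B_\Lambda,\mathbb C^2),\pi_\tau,D,\Gamma)$ is finitely summable and its dimension is $\delta$.
   Context: $\mathbb N=\{0,1,2,\dots\}$. A $k$-graph ($k\ge 1$) is a countable small category $\Lambda$ with a functor $d:\Lambda\to\mathbb N^k$ ($\mathbb N^k$ viewed as a one-object category under addition) such that whenever $d(\lambda)=m+n$ there are unique $\mu,\nu\in\Lambda$ with $d(\mu)=m$, $d(\nu)=n$, $\lambda=\mu\nu$. Here $\lambda\in\Lambda$ means $\lambda$ is a morphism; $\Lambda^n=d^{-1}(n)$; $\Lambda^0$ is identified with the objects (vertices); $r,s:\Lambda\to\Lambda^0$ are range and source. $\Lambda$ is finite if every $\Lambda^n$ is finite, and strongly connected if for all $v,w\in\Lambda^0$ there is $\lambda\in\Lambda$ with $r(\lambda)=v$, $s(\lambda)=w$. With $e_i$ the standard basis of $\mathbb N^k$, the adjacency matrices are $A_i(v,w)=\#\{\lambda\in\Lambda^{e_i}: r(\lambda)=v,\ s(\lambda)=w\}$; $\rho_i$ is the spectral radius of $A_i$. For $\Lambda$ finite and strongly connected, $x^\Lambda\in(0,\infty)^{\Lambda^0}$ is the unique positive vector with $\sum_v x^\Lambda_v=1$ and $A_ix^\Lambda=\rho_ix^\Lambda$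 for $1\le i\le k$. The stationary $k$-Bratteli diagram $\mathcal B_\Lambda$ has vertex set $\bigsqcup_{n\ge0}\mathcal V_n$, each $\mathcal V_n$ a copy of $\Lambda^0$, and edge set $\bigsqcup_{n\ge1}\mathcal E_n$, where for $n\equiv i \pmod k$, $1\le i\le k$, $\mathcal E_n$ contains exactly $A_i(p,q)$ edges with range $p\in\mathcal V_{n-1}$ and source $q\in\mathcal V_n$. $F\mathcal B_\Lambda$ is the set of finite paths $\eta=\eta_1\cdots\eta_m$ ($\eta_i\in\mathcal E_i$, $s(\eta_i)=r(\eta_{i+1})$), of length $|\eta|=m$; vertices in $\mathcal V_0$ are the paths of length $0$. $X_{\mathcal B_\Lambda}$ is the set of infinite paths $(x_n)_{n\ge1}$, $x_n\in\mathcal E_n$, $s(x_n)=r(x_{n+1})$, with the topology generated by the cylinder sets $[\lambda]$ = set of infinite paths with initial segment $\lambda\in F\mathcal B_\Lambda$. A weight is a function $w:F\mathcal B_\Lambda\to(0,\infty)$ with $\sum_{v\in\mathcal V_0}w(v)\le1$, $\lim_{n}\sup\{w(\lambda):|\lambda|=n\}=0$, and $w(\lambda)<w(\eta)$ whenever $\eta$ is a proper initial segment of $\lambda$. For $\delta\in(0,1)$ and $|\eta|=qk+t$ with $q\in\mathbb N$, $0\le t\le k-1$, $$w_\delta(\eta)=\big(\rho_1^{q+1}\cdots\rho_t^{q+1}\rho_{t+1}^q\cdots\rho_k^q\big)^{-1/\delta}x^\Lambda_{s(\eta)}.$$ For $x\ne y$ in $X_{\mathcal B_\Lambda}$, $x\wedge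 y$ is the longest common initial segment in $F\mathcal B_\Lambda$ ($\emptyset$ if $r(x)\neq r(y)$); $d_\delta(x,y)=w_\delta(x\wedge y)$ if $x\wedge y\ne\emptyset$, $d_\delta(x,y)=1$ if $x\wedge y=\emptyset$, and $d_\delta(x,x)=0$; $\operatorname{diam}[\lambda]=\sup\{d_\delta(x,y):x,y\in[\lambda]\}$. Under the hypotheses of the claim, $X_{\mathcal B_\Lambda}$ is a Cantor set and $d_\delta$ is an ultrametric inducing its topology. A choice function is a map $\tau=(\tau_+,\tau_-):F\mathcal B_\Lambda\to X_{\mathcal B_\Lambda}\times X_{\mathcal B_\Lambda}$ with $\tau(\gamma)\in[\gamma]\times[\gamma]$ and $d_\delta(\tau_+(\gamma),\tau_-(\gamma))=\operatorname{diam}[\gamma]$; $\tau$ denotes any choice function. $C_{\rm Lip}(X_{\mathcal B_\Lambda})$ is the algebra of Lipschitz functions for $d_\delta$; on $\mathcal H=\ell^2(F\mathcal B_\Lambda,\mathbb C^2)$ put $\pi_\tau(f)=\bigoplus_\gamma\mathrm{diag}(f(\tau_+(\gamma)),f(\tau_-(\gamma)))$, $D=\bigoplus_\gamma\frac1{\operatorname{diam}[\gamma]}\begin{pmatrix}0&1\\1&0\end{pmatrix}$, $\Gamma=1\otimes\mathrm{diag}(1,-1)$. This is an even spectral triple, the Pearson–Bellissard spectral triple. Its zeta function is $\zeta_\delta(s)=\frac12\operatorname{Tr}(|D|^{-s})=\sum_{\lambda\in F\mathcal B_\Lambda}w_\delta(\lambda)^s$. The spectral triple is $p$-summable if $\zeta_\delta(p)<\infty$,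 finitely summable if it is $p$-summable for some $p>0$, and its dimension is $\inf\{p>0:\zeta_\delta(p)<\infty\}$. *)

(* Defs.v *)
From HB Require Import structures.
From mathcomp Require Import all_boot all_order all_algebra.
From mathcomp Require Import all_classical all_reals all_analysis.
From mathcomp Require Import finmap spectral complex.

Set Implicit Arguments.
Unset Strict Implicit.
Unset Printing Implicit Defensive.

Import Order.TTheory GRing.Theory Num.Theory.
Import numFieldNormedType.Exports.

Local Open Scope classical_set_scope.
Local Open Scope ring_scope.

(* [hom v w] is the set of morphisms with range v and source w, so that
   [kcomp l m] is the composite written "lm". *)
Record kgraph (k : nat) := KGraph {
  vert : choiceType;
  hom : vert -> vert -> choiceType;
  idm : forall v, hom v v;
  kcomp : forall u v w, hom u v -> hom v w -> hom u w;
  deg : forall u v, hom u v -> {ffun 'I_k -> nat};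
  kgraph_gt0 : (0 < k)%N;
  kcomp_idl : forall u v (l : hom u v), kcomp (idm u) l = l;
  kcomp_idr : forall u v (l : hom u v), kcomp l (idm v) = l;
  kcompA : forall u v w z (l : hom u v) (m : hom v w) (n : hom w z),
    kcomp l (kcomp m n) = kcomp (kcomp l m) n;
  deg_id : forall v, deg (idm v) = 0;
  deg_kcomp : forall u v w (l : hom u v) (m : hom v w),
    deg (kcomp l m) = deg l + deg m;
  vert_countable : countable [set: vert];
  mor_countable : countable [set: {vw : vert * vert & hom vw.1 vw.2}];
  factorization : forall u w (l : hom u w) (m n : {ffun 'I_k -> nat}),
    deg l = m + n ->
    exists! p : {v : vert & (hom u v * hom v w)%type},
      [/\ deg (projT2 p).1 = m, deg (projT2 p).2 = n
        & kcomp (projT2 p).1 (projT2 p).2 = l] }.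

Section KGraphs.
Variables (k : nat) (L : kgraph k).

Definition arrow := {vw : vert L * vert L & hom vw.1 vw.2}.

Definition finite_kgraph :=
  forall n : {ffun 'I_k -> nat},
    finite_set [set l : arrow | deg (projT2 l) = n].

Definition strongly_connected :=
  forall v w : vert L, exists l : hom v w, True.

Definition unit_deg (i : 'I_k) : {ffun 'I_k -> nat} :=
  [ffun j => (j == i : nat)].

(* Meaningful when the graph is finite: [fset_set] of an infinite set is empty. *)
Definition adj (i : 'I_k) (v w : vert L) : nat :=
  #|` fset_set [set l : hom v w | deg l = unit_deg i]|%fset.

End KGraphs.

Definition spectral_radius (R : realType) (n : nat) (M : 'M[R[i]]_n) : R :=
  sup [set ComplexField.Normc.normc z | z in [set z | eigenvalue M z]].

Section PerronFrobenius.
Variables (R : realType) (k : nat) (L : kgraph k).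

Definition vertices : seq (vert L) := fset_set [set: vert L].

Definition adj_mx (i : 'I_k) : 'M[R[i]]_(size vertices) :=
  \matrix_(a, b) (adj i (tnth (in_tuple vertices) a)
                        (tnth (in_tuple vertices) b))%:R.

Definition rho (i : 'I_k) : R := spectral_radius (adj_mx i).

Definition is_perron_frobenius (x : vert L -> R) :=
  [/\ forall v, 0 < x v,
      \sum_(v \in [set: vert L]) x v = 1
    & forall i v, \sum_(w \in [set: vert L]) (adj i v w)%:R * x w
                  = rho i * x v].

End PerronFrobenius.

Section Bratteli.
Variables (k : nat) (L : kgraph k).

(* Levels and colours are numbered from 0: for n : nat, the edges joining
   V_n to V_{n+1} are counted by the adjacency matrix of index n mod k. *)
Definition color (n : nat) : 'I_k := Ordinal (ltn_pmod n (kgraph_gt0 L)).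

(* The triple (p, q, j), with j < A(p, q), is the j-th edge with range p and
   source q. *)
Definition edge : choiceType := (vert L * vert L * nat)%type.
Definition er (e : edge) : vert L := e.1.1.
Definition es (e : edge) : vert L := e.1.2.

Definition is_edge (n : nat) (e : edge) : bool :=
  (e.2 < adj (color n) (er e) (es e))%N.

Fixpoint is_path (n : nat) (v : vert L) (s : seq edge) : bool :=
  if s is e :: s' then [&& er e == v, is_edge n e & is_path n.+1 (es e) s']
  else true.

(* A finite path is recorded as its range together with its list of edges. *)
Definition finite_path : choiceType :=
  {p : vert L * seq edge | is_path 0 p.1 p.2}.

Definition vpath (v : vert L) : finite_path :=
  exist (fun p : vert L * seq edge => is_path 0 p.1 p.2) (v, [::]) isT.

Definition plen (h : finite_path) : nat := size (val h).2.
Definition psrc (h : finite_path) : vert L := last (val h).1 (map es (val h).2).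

Definition initial_segment (h l : finite_path) :=
  (val h).1 = (val l).1 /\ prefix (val h).2 (val l).2.

Record infinite_path := InfinitePath {
  iedge :> nat -> edge;
  ipath_edge : forall n, is_edge n (iedge n);
  ipath_chain : forall n, es (iedge n) = er (iedge n.+1) }.

Definition cylinder (l : finite_path) : set infinite_path :=
  [set x : infinite_path | er (x 0%N) = (val l).1 /\ mkseq x (plen l) = (val l).2].

Definition is_wedge (x y : infinite_path) (h : finite_path) :=
  [/\ cylinder h x, cylinder h y
    & forall m, cylinder m x -> cylinder m y -> (plen m <= plen h)%N].

(* [None] if x and y have no longest common initial segment, that is if
   r(x) <> r(y), or if x = y. *)
Definition wedge (x y : infinite_path) : option finite_path :=
  match pselect (exists h, is_wedge x y h) with
  | left ex => Some (projT1 (cid ex))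
  | right _ => None
  end.

End Bratteli.

Section Weights.
Variables (R : realType) (k : nat) (L : kgraph k).

(* When L is finite there are finitely many paths of each length, so that the
   suprema below are those of bounded sets. *)
Definition is_weight (w : finite_path L -> R) :=
  [/\ forall h, 0 < w h,
      \sum_(v \in [set: vert L]) w (vpath v) <= 1,
      (fun n : nat => sup [set w l | l in [set l | plen l = n]]) @ \oo --> (0 : R)
    & forall h l, initial_segment h l -> h != l -> w l < w h].

Definition wdelta (x : vert L -> R) (delta : R) (h : finite_path L) : R :=
  let q := (plen h %/ k)%N in
  let t := (plen h %% k)%N in
  (\prod_(i < k) rho R L i ^+ (if (i < t)%N then q.+1 else q))
    `^ (- delta^-1) * x (psrc h).

Definition wdist (w : finite_path L -> R) (x y : infinite_path L) : R :=
  if `[< x = y >] then 0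
  else if wedge x y is Some h then w h else 1.

Definition diam (w : finite_path L -> R) (l : finite_path L) : R :=
  sup [set r | exists x y, [/\ cylinder l x, cylinder l y & r = wdist w x y]].

Definition is_choice (w : finite_path L -> R) (tau : finite_path L -> infinite_path L * infinite_path L) :=
  forall l, [/\ cylinder l (tau l).1, cylinder l (tau l).2
              & wdist w (tau l).1 (tau l).2 = diam w l].

End Weights.

Section SpectralTriples.
Variables (R : realType).

Definition ell2 (I : choiceType) : set (I -> 'cV[R[i]]_2) :=
  [set xi : I -> 'cV[R[i]]_2 | (\esum_(g in [set: I])
     (\sum_(a < 2) ComplexField.Normc.normc (xi g a 0) ^+ 2)%:E < +oo)%E].

(* The operators occurring here are direct sums over I of operators on C^2;
   such a (possibly unbounded) operator T is given by the family of its blocks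
   and acts by (T xi) g = T g *m xi g on the xi in the Hilbert space such that
   T xi is again square-summable. *)
Definition block_op (I : choiceType) := I -> 'M[R[i]]_2.

Record triple (X : Type) (I : choiceType) := Triple {
  st_algebra : set (X -> R[i]);
  st_hilbert : set (I -> 'cV[R[i]]_2);
  st_rep : (X -> R[i]) -> block_op I;
  st_dirac : block_op I;
  st_grading : block_op I }.

(* Functional calculus of a normal matrix, from its diagonalization
   [orthomx_spectralP]. *)
Definition mxcalc (n : nat) (f : R[i] -> R[i]) (M : 'M[R[i]]_n) : 'M[R[i]]_n :=
  invmx (spectralmx M) *m diag_mx (map_mx f (spectral_diag M)) *m spectralmx M.

Definition abs_pow (I : choiceType) (D : block_op I) (s : R) : block_op I :=
  fun g => mxcalc (fun z => (ComplexField.Normc.normc z `^ s)%:C%C) (D g).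

(* Trace of a positive operator over the canonical orthonormal basis of
   l^2(I, C^2). *)
Definition op_trace (I : choiceType) (T : block_op I) : \bar R :=
  \esum_(g in [set: I]) (complex.Re (\tr (T g)))%:E.

Variables (X : Type) (I : choiceType).

Definition zeta (S : triple X I) (s : R) : \bar R :=
  ((2^-1)%:E * op_trace (abs_pow (st_dirac S) (- s)))%E.

Definition summable_at (S : triple X I) (p : R) := (zeta S p < +oo)%E.

Definition finitely_summable (S : triple X I) :=
  exists2 p : R, 0 < p & summable_at S p.

(* Infimum of a set of reals bounded below by 0; it is nonempty when S is
   finitely summable. *)
Definition dimension (S : triple X I) : R :=
  inf [set p : R | 0 < p /\ summable_at S p].

End SpectralTriples.

Section PearsonBellissard.
Variables (R : realType) (k : nat) (L : kgraph k) (w : finite_path L -> R).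

Definition lipschitz_algebra : set (infinite_path L -> R[i]) :=
  [set f | exists C : R, forall x y,
     ComplexField.Normc.normc (f x - f y) <= C * wdist w x y].

Definition pb_rep (tau : finite_path L -> infinite_path L * infinite_path L) (f : infinite_path L -> R[i]) :
    block_op R (finite_path L) :=
  fun g => diag_mx (\row_a (if a == 0 then f (tau g).1 else f (tau g).2)).

Definition pb_dirac : block_op R (finite_path L) :=
  fun g => (((diam w g)^-1)%:C)%C *: \matrix_(a, b) (a != b)%:R.

Definition pb_grading : block_op R (finite_path L) :=
  fun g => diag_mx (\row_a (if a == 0 then 1 else -1)).

Definition pearson_bellissard (tau : finite_path L -> infinite_path L * infinite_path L) :
    triple R (infinite_path L) (finite_path L) :=
  {| st_algebra := lipschitz_algebra;
     st_hilbert := ell2 (I := finite_path L);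
     st_rep := pb_rep tau;
     st_dirac := pb_dirac;
     st_grading := pb_grading |}.

End PearsonBellissard.

(* Main.v *)
Require Import Defs.
From mathcomp Require Import all_boot all_order all_algebra.
From mathcomp Require Import all_classical all_reals all_analysis.
From mathcomp Require Import finmap spectral complex ring.

(* Idea: write P n for the product of the spectral radii of the first n colours.
   Since x is a common eigenvector of the adjacency matrices with total mass 1,
   the sum of x (s h) over the paths h of length n is exactly P n.  As x takes
   finitely many positive values, the paths of length n contribute to zeta(s) an
   amount between two constant multiples of (P n)^(1 - s/delta).  That the
   diameters are positive makes infinite paths exist, so every spectral radius is
   positive; that the weight tends to 0 makes their product exceed 1, so P n grows
   exponentially.  Hence zeta(s) is finite exactly when s > delta. *)

Import Order.TTheory GRing.Theory Num.Theory.
Import numFieldNormedType.Exports.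

Set Implicit Arguments.
Unset Strict Implicit.
Unset Printing Implicit Defensive.

Local Open Scope classical_set_scope.
Local Open Scope ring_scope.

(** * Enumeration of finite paths by length *)

Section PathEnumeration.
Variables (k : nat) (L : kgraph k).

Definition out_edges (m : nat) (v : vert L) : seq (edge L) :=
  [seq (v, w, j) | w <- vertices L, j <- iota 0 (adj (color L m) v w)].

Fixpoint paths (n m : nat) (v : vert L) : seq (seq (edge L)) :=
  if n is n'.+1 then
    [seq e :: s | e <- out_edges m v, s <- paths n' m.+1 (es e)]
  else [:: [::]].

Definition level (n : nat) : seq (finite_path L) :=
  pmap insub [seq (v, s) | v <- vertices L, s <- paths n 0 v].

Hypothesis finV : finite_set [set: vert L].

Lemma mem_vertices v : v \in vertices L.
Proof. by rewrite in_fset_set// in_setT. Qed.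

Lemma uniq_vertices : uniq (vertices L). Proof. exact: fset_uniq. Qed.

Lemma mem_out_edges m v e : (e \in out_edges m v) = (er e == v) && is_edge m e.
Proof.
case: e => -[p q] j; rewrite /er /is_edge /=; apply/allpairsPdep/andP.
  by move=> [w [i [_]]]; rewrite mem_iota add0n => /= lt_i [-> -> ->].
by case=> /eqP <- lt_j; exists q, j; rewrite mem_vertices mem_iota.
Qed.

Lemma uniq_out_edges m v : uniq (out_edges m v).
Proof.
apply: allpairs_uniq_dep; first exact: uniq_vertices.
  by move=> w _; exact: iota_uniq.
by move=> [w i] [w' i'] _ _ /= [-> ->].
Qed.

Lemma mem_paths n m v s : (s \in paths n m v) = (size s == n) && is_path m v s.
Proof.
elim: n m v s => [|n IHn] m v [|e s] //=.
  by apply/negP => /allpairsPdep[? [? []]].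
apply/allpairsPdep/idP.
  move=> [e' [s' [+ + [-> ->]]]]; rewrite mem_out_edges IHn eqSS.
  by move=> /andP[-> ->] /andP[-> ->].
rewrite eqSS => /and4P[ss ev ee ps]; exists e, s.
by rewrite mem_out_edges IHn ev ee ss ps.
Qed.

Lemma uniq_paths n m v : uniq (paths n m v).
Proof.
elim: n m v => //= n IHn m v; apply: allpairs_uniq_dep => [|e _|].
- exact: uniq_out_edges.
- exact: IHn.
- by move=> [e s] [e' s'] _ _ /= [-> ->].
Qed.

Lemma mem_level n h : (h \in level n) = (plen h == n).
Proof.
rewrite mem_pmap_sub /plen; case: h => -[v s] /= ps.
apply/allpairsPdep/idP.
  by move=> [w [t [_ ht [_ ->]]]]; move: ht; rewrite mem_paths => /andP[].
by move=> ss; exists v, s; rewrite mem_vertices mem_paths ss.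
Qed.

Lemma uniq_level n : uniq (level n).
Proof.
apply/pmap_sub_uniq/allpairs_uniq_dep; first exact: uniq_vertices.
  by move=> v _; exact: uniq_paths.
by move=> [w i] [w' i'] _ _ /= [-> ->].
Qed.

(** [insub] discards nothing, since every listed edge sequence is a path. Sums over a level thus
    become double sums over ranges and edge lists. *)
Lemma map_val_level n :
  map val (level n) = [seq (v, s) | v <- vertices L, s <- paths n 0 v].
Proof.
rewrite pmap_filter; last exact: insubK.
apply/all_filterP/allP => p /allpairsPdep[v [s [_ + ->]]].
by rewrite mem_paths isSome_insub => /andP[].
Qed.

(** The levels are finite, pairwise disjoint and exhaust the paths. *)
Lemma esum_finite_path (R : realType) (f : finite_path L -> R) :
  (forall h, 0 <= f h) ->
  (\esum_(h in [set: finite_path L]) (f h)%:E =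
   \sum_(n <oo) (\sum_(h <- level n) f h)%:E)%E.
Proof.
move=> f0.
have -> : [set: finite_path L] = \bigcup_n [set` level n].
  by apply/seteqP; split=> // h _; exists (plen h) => //=; rewrite mem_level.
rewrite nneseries_sum_bigcup//.
  apply: eq_eseriesr => n _; rewrite esum_fset//.
    by rewrite -fsbig_seq ?uniq_level// sumEFin.
  by move=> i _; rewrite lee_fin.
apply/trivIsetP => i j _ _ ij; apply/seteqP; split=> // h /=.
by rewrite !mem_level => -[/eqP ->]; apply/negP.
Qed.

End PathEnumeration.

(* One more edge raises by one the exponent of its own colour only. *)
Lemma divn_modnS (k n i : nat) : (0 < k)%N -> (i < k)%N ->
  (if (i < n.+1 %% k)%N then (n.+1 %/ k).+1 else n.+1 %/ k)%N =
  ((if (i < n %% k)%N then (n %/ k).+1 else n %/ k) + (i == n %% k))%N.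
Proof.
move=> k0 ik; have tk := ltn_pmod n k0; rewrite {1 2 3}(divn_eq n k) -addnS.
move: (n %/ k)%N (n %% k)%N tk => q t tk; rewrite !divnMDl// modnMDl.
have [tk1|] := ltnP t.+1 k.
  rewrite divn_small// modn_small// addn0 ltnS.
  by case: (ltngtP i t); rewrite ?addn0 ?addn1.
(* Carry case: the remainder wraps to 0 and the quotient grows by one. *)
move=> kt; have {kt tk}tk : t.+1 = k by apply/eqP; rewrite eqn_leq tk kt.
rewrite tk modnn divnn k0 ltn0 addn1; move: ik; rewrite -tk ltnS.
by case: ltngtP; rewrite ?addn0 ?addn1.
Qed.

(** * Perron-Frobenius sums over levels and positivity of the spectral radii *)

Section Weights.
Variables (R : realType) (k : nat) (L : kgraph k) (x : vert L -> R).
Hypothesis hx : is_perron_frobenius x.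

Let k0 : (0 < k)%N := kgraph_gt0 L.

Definition rho_prod (n : nat) : R :=
  \prod_(i < k) rho R L i ^+ (if (i < n %% k)%N then (n %/ k).+1 else n %/ k)%N.

Lemma wdeltaE delta h :
  wdelta x delta h = rho_prod (plen h) `^ (- delta^-1) * x (psrc h).
Proof. by []. Qed.

Lemma rho_prod0 : rho_prod 0 = 1.
Proof. by rewrite /rho_prod big1// => i _; rewrite mod0n div0n ltn0. Qed.

Lemma rho_prodS n : rho_prod n.+1 = rho_prod n * rho R L (color L n).
Proof.
have -> : rho R L (color L n) = \prod_(i < k) rho R L i ^+ (i == color L n).
  rewrite (bigD1 (color L n) isT) /= [X in _ * X]big1 => [|i /negbTE ->//].
  by rewrite mulr1 eqxx expr1.
rewrite /rho_prod -big_split; apply: eq_bigr => i _.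
by rewrite divn_modnS// exprD -val_eqE.
Qed.

Lemma rho_prod_period n : rho_prod (n + k) = rho_prod n * \prod_(i < k) rho R L i.
Proof.
rewrite /rho_prod -big_split/=; apply: eq_bigr => i _.
rewrite modnDr divnDr// divnn k0 addn1 -exprSr.
by case: ifP.
Qed.

(** As [x] vanishes nowhere, infinitely many vertices would give its sum an infinite support; such a
    sum defaults to 0, but it is 1. *)
Lemma finite_vertices : finite_set [set: vert L].
Proof.
have [x0 x1 _] := hx; apply: contrapT => infV; move: x1.
rewrite fsbig_dflt; first by move/eqP; rewrite eq_sym oner_eq0.
rewrite [X in infinite_set X](_ : _ = setT)//; apply/seteqP; split=> // v _.
by split=> //= /eqP; rewrite gt_eqF.
Qed.
Let finV := finite_vertices.

Lemma sum_perron_frobenius : \sum_(v <- vertices L) x v = 1.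
Proof. by have [_ <- _] := hx; rewrite fsbig_finite. Qed.

Lemma adj_perron_frobenius i v :
  \sum_(w <- vertices L) (adj i v w)%:R * x w = rho R L i * x v.
Proof. by have [_ _ <-] := hx; rewrite fsbig_finite. Qed.

(** Removing the first edge applies one adjacency matrix to the eigenvector [x], which yields one
    spectral radius. *)
Lemma sum_paths n m v :
  \sum_(s <- paths n m v) x (last v (map (es (L := L)) s)) =
  (\prod_(m <= i < m + n) rho R L (color L i)) * x v.
Proof.
elim: n m v => [|n IHn] m v; first by rewrite /= big_seq1 addn0 big_geq// mul1r.
rewrite /= big_allpairs_dep /=; under eq_bigr do rewrite IHn.
rewrite big_allpairs_dep /es /=.
rewrite addnS -addSn [in RHS]big_ltn ?leq_addr// mulrAC -adj_perron_frobenius mulr_suml.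
apply: eq_bigr => w _.
(* Parallel edges contribute equally, so their number [adj] becomes a factor. *)
by rewrite big_const_seq count_predT size_iota iter_addr_0; ring.
Qed.

Lemma sum_level n : \sum_(h <- level L n) x (psrc h) = rho_prod n.
Proof.
rewrite /psrc -(big_map val xpredT
  (fun p : vert L * seq (edge L) => x (last p.1 (map (es (L := L)) p.2)))).
rewrite map_val_level// big_allpairs_dep /=.
under eq_bigr do rewrite sum_paths.
rewrite -mulr_sumr sum_perron_frobenius mulr1 add0n.
elim: n => [|n IHn]; first by rewrite big_geq// rho_prod0.
by rewrite big_nat_recr//= IHn rho_prodS.
Qed.

Lemma rho_ge0 i : 0 <= rho R L i.
Proof.
have [x0 _ _] := hx.
have /eqP := sum_perron_frobenius.
case: (vertices L) => [|v ?]; first by rewrite big_nil eq_sym oner_eq0.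
move=> _; rewrite -(pmulr_lge0 _ (x0 v)) -adj_perron_frobenius.
by apply: sumr_ge0 => w _; rewrite mulr_ge0// ltW.
Qed.

(** If [rho i] were 0, the positivity of [x] would force the adjacency matrix of colour [i] to
    vanish, yet edge [i] of [y] has that colour. *)
Lemma rho_gt0 (y : infinite_path L) i : 0 < rho R L i.
Proof.
have [x0 _ _] := hx; rewrite lt_neqAle rho_ge0 andbT; apply/eqP => rho0.
have := ipath_edge y i; rewrite /is_edge.
set v := er _; set w := es _.
have -> : color L i = i by apply/val_inj; rewrite /= modn_small.
suff -> : adj i v w = 0%N by [].
have /eqP := adj_perron_frobenius i v; rewrite -rho0 mul0r.
rewrite psumr_eq0; last by move=> u _; rewrite mulr_ge0// ltW.
move=> /allP/(_ w (mem_vertices finV w)); rewrite mulf_eq0 (gt_eqF (x0 w)) orbF.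
by rewrite pnatr_eq0 => /eqP.
Qed.

End Weights.

(** * Trace of a power of a Dirac block *)

Section Trace.
Variable R : realType.

Lemma normc_eq_sqr (z : R[i]) (c : R) : z ^+ 2 = ((c ^+ 2)%:C)%C ->
  ComplexField.Normc.normc z = `|c|.
Proof.
rewrite rmorphXn => /eqP; rewrite eqf_sqr => /orP[]/eqP->;
  rewrite /ComplexField.Normc.normc /=.
  by rewrite expr0n addr0 sqrtr_sqr.
by rewrite oppr0 expr0n addr0 sqrtr_sqr normrN.
Qed.

(** The block squares to [c ^+ 2], so each eigenvalue has modulus [|c|]; the diagonalization need
    not be computed. *)
Lemma mxtrace_mxcalc_swap (c s : R) :
  \tr (mxcalc (fun z => ((ComplexField.Normc.normc z `^ s)%:C)%C)
    ((c%:C)%C *: \matrix_(a < 2, b < 2) (a != b)%:R)) = ((2 * `|c| `^ s)%:C)%C.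
Proof.
set A : 'M[R[i]]_2 := _ *: _.
have A2 : A *m A = (((c ^+ 2)%:C)%C)%:M.
  apply/matrixP => i j; rewrite !mxE !big_ord_recl big_ord0 !mxE.
  case: i => -[|[|//]] ?; case: j => -[|[|//]] ?; rewrite /= ?mulr0 ?mulr1 ?mul0r;
    by rewrite ?addr0 ?add0r ?mulr0n ?mulr1n ?rmorphXn ?expr2.
have /orthomx_spectralP An : A \is normalmx.
  suff At : map_mx Num.conj A^T = A by apply/normalmxP; rewrite At.
  apply/matrixP => i j; rewrite !mxE eq_sym rmorphM /= rmorph_nat.
  by congr (_ * _); exact: conjc_real.
have Pu := spectral_unit A; rewrite /mxcalc.
move: (spectralmx A) (spectral_diag A) Pu An => P d Pu An.
have d2 i : d 0 i ^+ 2 = ((c ^+ 2)%:C)%C.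
  have : diag_mx d *m diag_mx d = (((c ^+ 2)%:C)%C)%:M.
    have -> : diag_mx d = P *m A *m invmx P.
      by rewrite An !mulmxA mulmxV// mul1mx mulmxK.
    rewrite -!mulmxA (mulmxA (invmx P)) mulVmx// mul1mx (mulmxA A) A2.
    by rewrite -scalar_mxC mulKVmx.
  by rewrite mulmx_diag => /matrixP/(_ i i); rewrite !mxE eqxx !mulr1n expr2.
(* By cyclicity of the trace the change of basis cancels. *)
rewrite mxtrace_mulC mulmxA mulmxV// mul1mx mxtrace_diag.
rewrite !big_ord_recl big_ord0 !mxE !(normc_eq_sqr (d2 _)).
by rewrite addr0 -rmorphD mulr2n mulrDl mul1r.
Qed.

Lemma seq_lower_bound (T : eqType) (r : seq T) (f : T -> R) :
  (forall t, 0 < f t) -> exists2 a, 0 < a & {in r, forall t, a <= f t}.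
Proof.
move=> f0; elim: r => [|t r [a a0 ar]]; first by exists 1.
exists (Num.min a (f t)); first by rewrite lt_min a0 f0.
move=> u; rewrite inE => /predU1P[->|/ar]; first by rewrite ge_min lexx orbT.
by rewrite ge_min => ->.
Qed.

End Trace.

(** * The zeta function as a series over levels *)

Section Zeta.
Variables (R : realType) (k : nat) (L : kgraph k) (w : finite_path L -> R).
Hypotheses (finV : finite_set [set: vert L]) (w0 : forall h, 0 < w h).
Hypothesis (hdiam : forall h, w h = diam w h).

Lemma zeta_pearson_bellissard tau s :
  zeta (pearson_bellissard w tau) s =
  (\sum_(n <oo) (\sum_(h <- level L n) w h `^ s)%:E)%E.
Proof.
rewrite /zeta /op_trace.
rewrite (eq_esum (b := fun h => (2 * w h `^ s)%:E)); last first.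
  move=> h _; rewrite /abs_pow /= /pb_dirac mxtrace_mxcalc_swap /= -hdiam.
  by rewrite gtr0_norm ?invr_gt0// -powR_inv1 ?ltW// -powRrM mulN1r opprK.
rewrite esum_finite_path//; last by move=> h; rewrite mulr_ge0 ?powR_ge0.
under eq_eseriesr do rewrite -mulr_sumr EFinM.
rewrite nneseriesZl; last first.
  by move=> n _; rewrite lee_fin sumr_ge0// => h _; exact: powR_ge0.
by rewrite muleA -EFinM mulVf ?mul1e// pnatr_eq0.
Qed.

End Zeta.

(** * Exponential growth and two-sided bounds on level sums *)

Section Growth.
Variables (R : realType) (k : nat) (L : kgraph k) (x : vert L -> R).
Hypothesis hx : is_perron_frobenius x.
Hypothesis rho0 : forall i, 0 < rho R L i.

Let k0 : (0 < k)%N := kgraph_gt0 L.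
Let finV := finite_vertices hx.
Let x0 : forall v, 0 < x v. Proof. by have [] := hx. Qed.
Let P := rho_prod R L.

Lemma rho_prod_gt0 n : 0 < P n.
Proof. by apply: prodr_gt0 => i _; exact: exprn_gt0. Qed.

(** [beta] is the [k]-th root of the product over one period, and [c] the least value of
    [P n / beta ^+ n] over the first period; both sides gain the same factor in each further
    period. *)
Lemma rho_prod_exp_growth : 1 < \prod_(i < k) rho R L i ->
  exists c beta, [/\ 0 < c, 1 < beta & forall n, c * beta ^+ n <= P n].
Proof.
set r := \prod_(i < k) _ => r1; have rg0 : 0 < r by exact: lt_trans r1.
pose b := r `^ k%:R^-1.
have b0 : 0 < b by exact: powR_gt0.
have bk : b ^+ k = r.
  by rewrite -powR_mulrn ?ltW// -powRrM mulVf ?powRr1 ?ltW// pnatr_eq0 -lt0n.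
have b1 : 1 < b.
  suff: 1 `^ k%:R^-1 < b by rewrite powR1.
  rewrite gt0_ltr_powR// ?nnegrE ?ltW//.
  by rewrite invr_gt0 ltr0n.
have [n|c c0 cP] := @seq_lower_bound R _ (iota 0 k) (fun n => P n / b ^+ n).
  by rewrite divr_gt0 ?rho_prod_gt0// exprn_gt0.
exists c, b; split => // n.
elim/ltn_ind: n => n IHn; have [nk|kn] := ltnP n k.
  by rewrite -ler_pdivlMr ?exprn_gt0// cP// mem_iota.
rewrite -(subnK kn) exprD mulrA bk /P rho_prod_period -/r ler_pM2r//.
by apply: IHn; rewrite ltn_subrL k0 (leq_trans k0 kn).
Qed.

Lemma path_of_length n : exists h : finite_path L, plen h = n.
Proof.
have /eqP := sum_level hx n; case E: (level L n) => [|h l] => [|_].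
  by rewrite big_nil eq_sym gt_eqF// rho_prod_gt0.
by exists h; apply/eqP; rewrite -(mem_level finV) E mem_head.
Qed.

Lemma perron_frobenius_le1 v : x v <= 1.
Proof.
rewrite -(sum_perron_frobenius hx) (bigD1_seq v) ?mem_vertices ?uniq_vertices//=.
by rewrite lerDl sumr_ge0// => w _; exact: ltW.
Qed.

(** Otherwise [P] is at most 1 at multiples of [k], so there the weights stay above the minimum of
    [x] and cannot tend to 0. *)
Lemma prod_rho_gt1 delta : 0 < delta -> is_weight (wdelta x delta) ->
  1 < \prod_(i < k) rho R L i.
Proof.
move=> d0 [w0 _ wlim _]; rewrite ltNge; apply/negP => r1.
have [a a0 ax] := seq_lower_bound (vertices L) x0.
have /cvgrPdist_lt/(_ _ a0) [N _ /(_ (N * k)%N)] := wlim.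
rewrite /= leq_pmulr// => /(_ isT); rewrite sub0r normrN ltNge => /negP; apply.
have P1 : P (N * k) <= 1.
  elim: N => [|n IHn]; first by rewrite /P rho_prod0.
  rewrite mulSn addnC /P rho_prod_period mulr_ile1//; first exact/ltW/rho_prod_gt0.
  by apply: prodr_ge0 => i _; exact: ltW.
have [h hn] := path_of_length (N * k).
apply: le_trans (ler_norm _); apply: (@le_trans _ _ (wdelta x delta h)).
  rewrite wdeltaE hn; apply: (le_trans (ax _ (mem_vertices finV (psrc h)))).
  rewrite ler_peMl ?(ltW (x0 _))// powRN invf_ge1 ?powR_gt0 ?rho_prod_gt0//.
  suff: P (N * k) `^ delta^-1 <= 1 `^ delta^-1 by rewrite powR1.
  rewrite ge0_ler_powR ?nnegrE// ?invr_ge0 ?ltW//.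
  exact: rho_prod_gt0.
(* [sup] dominates its elements only for a set bounded above; [x <= 1] supplies a bound. *)
apply: ub_le_sup; last by exists h.
exists (P (N * k) `^ (- delta^-1)) => _ [l /= ln <-].
by rewrite wdeltaE ln ler_piMr ?powR_ge0// perron_frobenius_le1.
Qed.

(** Write [x ^ s] as [f * x] with [f] bounded above and below on the finite vertex set: the factor
    [P n] from the sum of [x] over the level joins [P n] to the power [- s / delta]. *)
Lemma sum_level_wdelta_powR delta s : 0 < delta -> exists a b, [/\ 0 < a, 0 < b &
  forall n, a * P n `^ (1 - s / delta) <=
    \sum_(h <- level L n) wdelta x delta h `^ s <= b * P n `^ (1 - s / delta)].
Proof.
move=> d0; pose f v := x v `^ s / x v.
have f0 v : 0 < f v by rewrite divr_gt0// powR_gt0.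
have [a a0 af] := seq_lower_bound (vertices L) f0.
(* An upper bound for [f] is obtained as the inverse of a lower bound for [1 / f]. *)
have [b b0 bf] : exists2 b, 0 < b & {in vertices L, forall v, b <= (f v)^-1}.
  by apply: seq_lower_bound => v; rewrite invr_gt0.
exists a, b^-1; split => [//||n]; first by rewrite invr_gt0.
have Pn0 := rho_prod_gt0 n.
have -> : \sum_(h <- level L n) wdelta x delta h `^ s =
    P n `^ (- (s / delta)) * \sum_(h <- level L n) f (psrc h) * x (psrc h).
  rewrite mulr_sumr; apply: eq_big_seq => h; rewrite mem_level// => /eqP hn.
  rewrite wdeltaE hn powRM ?powR_ge0 ?ltW// -powRrM mulrC mulNr [delta^-1 * s]mulrC.
  by rewrite /f divfK ?gt_eqF// mulrC.
have -> : P n `^ (1 - s / delta) = P n `^ (- (s / delta)) * P n.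
  by rewrite addrC powRD ?powRr1 ?ltW// (gt_eqF Pn0) implybT.
rewrite !(mulrCA _ (P n `^ _)).
rewrite !ler_pM2l ?powR_gt0// /P -(sum_level hx) !mulr_sumr.
apply/andP; split; apply: ler_sum => h _; rewrite ler_pM2r//.
  by rewrite af// mem_vertices.
by rewrite -[leLHS]invrK lef_pV2 ?posrE ?invr_gt0// bf// mem_vertices.
Qed.

End Growth.

(** * Convergence and divergence criteria for nonnegative series *)

Section Series.
Variables (R : realType) (u : nat -> R).

Lemma nneseries_le_geometric_lty (B z : R) : 0 <= B -> 0 < z < 1 ->
  (forall n, 0 <= u n <= B * z ^+ n) -> (\sum_(n <oo) (u n)%:E < +oo)%E.
Proof.
move=> B0 /andP[z0 z1] uB.
apply: (@le_lt_trans _ _ (B * (1 - z)^-1)%:E); last exact: ltry.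
apply: lime_le.
  by apply: is_cvg_nneseries => n _ _; rewrite lee_fin; have /andP[] := uB n.
near=> n; rewrite sumEFin lee_fin.
apply: (@le_trans _ _ (series (geometric B z) n)).
  by apply: ler_sum => i _; have /andP[] := uB i.
by apply: geometric_le_lim; rewrite ?gtr0_norm.
Unshelve. all: by end_near. Qed.

Lemma nneseries_ge_cst_pinfty (c : R) : 0 < c -> (forall n, c <= u n) ->
  (\sum_(n <oo) (u n)%:E = +oo)%E.
Proof.
move=> c0 cu; apply/eqyP => A A0; pose N := (Num.bound (A / c)).
have u0 n : 0 <= u n by rewrite (le_trans _ (cu n))// ltW.
apply: (@le_trans _ _ (\sum_(0 <= n < N) (u n)%:E)%E); last first.
  by apply: nneseries_lim_ge => n _ _; rewrite lee_fin.
rewrite sumEFin lee_fin; apply: (@le_trans _ _ (\sum_(0 <= n < N) c)).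
  rewrite sumr_const_nat subn0 -mulr_natl -ler_pdivrMr// ltW//.
  by apply: archi_boundP; rewrite divr_ge0// ltW.
exact: ler_sum.
Qed.

End Series.

(** * Summability exactly above [delta] *)

Section Dimension.
Variables (R : realType) (k : nat) (L : kgraph k) (x : vert L -> R) (delta : R).
Hypotheses (hx : is_perron_frobenius x) (delta0 : 0 < delta).
Hypothesis hweight : is_weight (wdelta x delta).
Hypothesis hdiam : forall l, wdelta x delta l = diam (wdelta x delta) l.

(** Without infinite paths a diameter would be the supremum of the empty set, which is 0 by default,
    whereas weights are positive. *)
Lemma inhabited_infinite_path : inhabited (infinite_path L).
Proof.
have [w0 _ _ _] := hweight.
have [v _] : exists v, v \in vertices L.
  have /eqP := sum_perron_frobenius hx; case: (vertices L) => [|v r _].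
    by rewrite big_nil eq_sym oner_eq0.
  by exists v; exact: mem_head.
have := w0 (vpath v); rewrite hdiam /diam; set S := [set _ | _].
case: (pselect (S !=set0)) => [[_ [y _]] _|]; first by exists.
by move=> /nonemptyPn ->; rewrite sup0 ltxx.
Qed.

Lemma summable_pearson_bellissardP tau s :
  summable_at (pearson_bellissard (wdelta x delta) tau) s <-> delta < s.
Proof.
have [w0 _ _ _] := hweight; have [y] := inhabited_infinite_path.
have rho0 := rho_gt0 hx y.
have [c [beta [c0 beta1 cP]]] :=
  rho_prod_exp_growth rho0 (prod_rho_gt1 hx rho0 delta0 hweight).
have beta0 : 0 < beta by exact: lt_trans beta1.
have [a [b [a0 b0 ab]]] := sum_level_wdelta_powR hx rho0 s delta0.
rewrite /summable_at (zeta_pearson_bellissard (finite_vertices hx) w0 hdiam).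
have P0 := rho_prod_gt0 rho0.
split; last first.
  (* For [delta < s], the bound [c * beta ^+ n <= P n] raised to the negative power [- e] gives a
     geometric majorant of ratio [(beta ^ e)^-1 < 1]. *)
  move=> ds; set e := s / delta - 1.
  have e0 : 0 < e by rewrite subr_gt0 ltr_pdivlMr ?mul1r.
  apply: (@nneseries_le_geometric_lty _ _ (b * (c `^ e)^-1) (beta `^ e)^-1).
  - by rewrite mulr_ge0 ?invr_ge0 ?powR_ge0// ltW.
  - rewrite invr_gt0 powR_gt0//= invf_lt1 ?powR_gt0//.
    suff: 1 `^ e < beta `^ e by rewrite powR1.
    by rewrite gt0_ltr_powR// nnegrE ltW.
  - move=> n; rewrite sumr_ge0/=; last by move=> h _; exact: powR_ge0.
    have /andP[_ /le_trans] := ab n; apply.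
    rewrite -mulrA ler_pM2l// exprVn -invfM -opprB -/e powRN.
    rewrite lef_pV2 ?posrE ?powR_gt0//; last first.
      by rewrite mulr_gt0 ?exprn_gt0 ?powR_gt0.
    rewrite -powR_mulrn ?powR_ge0// powRAC powR_mulrn ?(ltW beta0)//.
    rewrite -powRM ?exprn_ge0 ?(ltW c0) ?(ltW beta0)//.
    by rewrite ge0_ler_powR ?nnegrE ?mulr_ge0 ?exprn_ge0 ?(ltW c0) ?(ltW beta0)
               ?(ltW e0) ?(ltW (P0 n)).
(* For [s <= delta] the exponent [e] is nonnegative and [P n >= c], so the terms stay above
   [a * c ^ e] and the series diverges. *)
apply: contraTT; rewrite -leNgt => sd; set e := 1 - s / delta in ab.
have e0 : 0 <= e by rewrite subr_ge0 ler_pdivrMr ?mul1r.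
rewrite (@nneseries_ge_cst_pinfty _ _ (a * c `^ e)) ?ltxx ?mulr_gt0 ?powR_gt0// => n.
have /andP[+ _] := ab n; apply: le_trans; rewrite ler_pM2l//.
rewrite ge0_ler_powR ?nnegrE ?(ltW c0) ?(ltW (P0 n))//.
apply: le_trans (cP n).
by rewrite ler_peMr ?(ltW c0)// exprn_ege1// ltW.
Qed.

End Dimension.

Theorem corollary3p15 (R : realType) (k : nat) (L : kgraph k)
    (hfin : finite_kgraph L) (hconn : strongly_connected L)
    (x : vert L -> R) (hx : is_perron_frobenius x)
    (delta : R) (hdelta0 : 0 < delta) (hdelta1 : delta < 1)
    (hweight : is_weight (wdelta x delta))
    (hdiam : forall l : finite_path L,
       wdelta x delta l = diam (wdelta x delta) l)
    (tau : finite_path L -> infinite_path L * infinite_path L)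
    (htau : is_choice (wdelta x delta) tau) :
  finitely_summable (pearson_bellissard (wdelta x delta) tau) /\
  dimension (pearson_bellissard (wdelta x delta) tau) = delta.
Proof.
have summableP := summable_pearson_bellissardP hx hdelta0 hweight hdiam tau.
(* The exponent 1 works because [delta < 1]. *)
split; first by exists 1 => //; apply/summableP.
rewrite /dimension [X in inf X](_ : _ = `]delta, +oo[%classic) ?inf_itv//.
apply/seteqP; split=> p /=; rewrite in_itv/= andbT; first by move=> [_ /summableP].
by move=> dp; split; [exact: lt_trans dp|apply/summableP].
Qed.
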